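(* Let $K$ be a finite field, let $X=K$, and let $s,t\in K^\times$ with $t\neq s^{-1}$ be such that $\{-1,s,t\}$ generates $K^\times$ as a multiplicative group. Let $S:K\times K\to K\times K$ be the bialexander switch $S(x,y)=S_{s,t}(x,y)=(sy,\ tx+(1-st)y)$. If $\tau=(\tau^1,\tau^2):K^2\to K^2$ is such that $(K,S,\tau)$ is a singular pair, then: 1. $\tau:K^2\to K^2$ is necessarily a $K$-linear map. 2. Denoting $a:=\tau^1(0,1)$, one has $a\in K^\times$, $\tau^1(0,y)=ay$ and $\tau^2(sx,0)=atx$ for all $x,y\in K$, and $$\tau(x,y)=\tau_a(x,y):=\Big(ay+\big(1-\tfrac{a}{s}\big)x\ ,\ \tfrac{at}{s}x+(1-at)y\Big)\quad\text{for all }x,y\in K.$$ 3. For $a\in K^\times$, the map $\tau_a$ is bijective if and only if $(st+1)a\neq s$. In particular, $\tau$ is necessarily linear and there are at most $|K|-1$ singular pairs for $S_{s,t}$ (i.e. at most $|K|-1$ maps $\tau$ such that $(K,S_{s,t},\tau)$ is a singular pair).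
   Context: For a map $T:X\times X\to X\times X$ write $T(x,y)=(T^1(x,y),T^2(x,y))$. $T$ is left invertible if for any $x,z\in X$ there is a unique $y$ with $T^1(x,y)=z$; it is right invertible if for any $y,w\in X$ there is a unique $x$ with $T^2(x,y)=w$. A biquandle is a pair $(X,S)$, where $S:X\times X\to X\times X$ is a bijection, left and right invertible, satisfying the set-theoretical Yang-Baxter equation $(\mathrm{Id}\times S)(S\times \mathrm{Id})(\mathrm{Id}\times S)=(S\times \mathrm{Id})(\mathrm{Id}\times S)(S\times \mathrm{Id})$, and such that there is a bijection $\mathbf{s}:X\to X$ with $\{(x,y):S(x,y)=(x,y)\}=\{(x,\mathbf{s}(x)):x\in X\}$. (The bialexander switch above is a biquandle.) Given a biquandle $(X,S)$ and a bijective, left and right invertible map $\tau:X\times X\to X\times X$, the triple $(X,S,\tau)$ is called a singular pair if $$\tau\circ S=S\circ\tau,$$ $$(S\times 1)(1\times S)(\tau\times 1)=(1\times \tau)(S\times 1)(1\times S),$$ $$(1\times S)(S\times 1)(1\times \tau)=(\tau\times 1)(1\times S)(S\times 1)$$ as maps $X^3\to X^3$. *)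

(* Defs.v *)
From HB Require Import structures.
From mathcomp Require Import all_boot all_order all_algebra.

Set Implicit Arguments.
Unset Strict Implicit.
Unset Printing Implicit Defensive.

Import GRing.Theory.
Local Open Scope ring_scope.

Definition left_invertible (X : Type) (T : X * X -> X * X) : Prop :=
  forall x z : X, exists! y : X, (T (x, y)).1 = z.

Definition right_invertible (X : Type) (T : X * X -> X * X) : Prop :=
  forall y w : X, exists! x : X, (T (x, y)).2 = w.

(* [on12 T] is T x Id and [on23 T] is Id x T on X^3 = (X * X) * X. *)
Definition on12 (X : Type) (T : X * X -> X * X) (p : X * X * X) : X * X * X :=
  (T p.1, p.2).

Definition on23 (X : Type) (T : X * X -> X * X) (p : X * X * X) : X * X * X :=
  (p.1.1, (T (p.1.2, p.2)).1, (T (p.1.2, p.2)).2).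

Definition yang_baxter (X : Type) (S : X * X -> X * X) : Prop :=
  on23 S \o on12 S \o on23 S =1 on12 S \o on23 S \o on12 S.

Definition biquandle (X : Type) (S : X * X -> X * X) : Prop :=
  [/\ bijective S, left_invertible S, right_invertible S, yang_baxter S &
      exists2 sb : X -> X, bijective sb &
        forall x y : X, S (x, y) = (x, y) <-> y = sb x].

Record singular_pair (X : Type) (S tau : X * X -> X * X) : Prop :=
  SingularPair {
    sp_biquandle : biquandle S;
    sp_bij : bijective tau;
    sp_linv : left_invertible tau;
    sp_rinv : right_invertible tau;
    sp_comm : tau \o S =1 S \o tau;
    sp_braid12 : on12 S \o on23 S \o on12 tau =1 on23 tau \o on12 S \o on23 S;
    sp_braid23 : on23 S \o on12 S \o on23 tau =1 on12 tau \o on23 S \o on12 S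
  }.

Definition bialexander (K : fieldType) (s t : K) (p : K * K) : K * K :=
  (s * p.2, t * p.1 + (1 - s * t) * p.2).

Definition tau_lin (K : fieldType) (s t a : K) (p : K * K) : K * K :=
  (a * p.2 + (1 - a / s) * p.1, a * t / s * p.1 + (1 - a * t) * p.2).

(* Main.v *)
Require Import Defs.
From HB Require Import structures.
From mathcomp Require Import all_boot all_order all_fingroup all_algebra.
From mathcomp Require Import boolp.
From mathcomp Require Import ring.

Import GRing.Theory.
Local Open Scope ring_scope.

(** Everything about [tau] is carried by the one-variable function
    phi(x) = tau^1(x, 0).  Comparing coordinates in the two mixed braid relations
    turns them into scalar identities: [tau] commutes with multiplication by
    [s] and by [t], it commutes with translations along the line spanned by
    (s, 1), and t tau^1(x, y) + tau^2(x, y) = t x + y.  The line of translations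
    is the set of fixed points of [S], and 1 - st <> 0 is what allows every
    translation along it to be reached.  Translating by -y (s, 1) gives
    tau^1(x, y) = phi(x - s y) + s y, and the last identity then yields tau^2.

    Once [tau] is written in terms of phi, the relation tau S = S tau says
    exactly phi(- s t u) = - s t phi(u).  Since phi commutes with the scalings
    by [s] and [t], it therefore also commutes with -1.  The scalars that commute
    with phi form a multiplicative group, so by the generation hypothesis all of
    K^* does, and phi(u) = phi(1) u.  Only the parameter phi(1), equivalently
    a = tau^1(0, 1) = s (1 - phi(1)), is left free, which gives the formula for
    [tau]; left invertibility forces a <> 0, whence the bound |K| - 1.

    The bijectivity criterion is the nonvanishing of the determinant of
    [tau_lin s t a], which equals 1 - a/s - a t. *)

(** The units [u] that commute with [phi] are closed under products, and in a
    finite group this suffices for them to form a subgroup. *)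
Lemma homogeneous_of_generators {K : finFieldType} (phi : K -> K)
    (A : {set {unit K}}) :
    <<A>>%g = [set: {unit K}] ->
    (forall u, u \in A -> forall x, phi (val u * x) = val u * phi x) ->
  forall c x : K, c != 0 -> phi (c * x) = c * phi x.
Proof.
move=> genA homA c x c0.
pose H := [set u : {unit K} | [forall z, phi (val u * z) == val u * phi z]].
have gH : group_set H.
  apply/group_setP; split=> [|u v].
    by rewrite inE; apply/forallP=> z; rewrite /= !mul1r.
  rewrite !inE => /forallP hu /forallP hv; apply/forallP=> z /=.
  by rewrite -!mulrA (eqP (hu _)) (eqP (hv _)).
have sAH : <<A>>%g \subset Group gH.
  rewrite gen_subG; apply/subsetP=> u uA; rewrite inE.
  by apply/forallP=> z; rewrite homA.
have c_unit : c \is a GRing.unit by rewrite unitfE.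
have /(subsetP sAH) : FinRing.unit K c_unit \in <<A>>%g by rewrite genA inE.
by rewrite inE => /forallP /(_ x) /eqP.
Qed.

Section SingularPair.

Context {K : fieldType} {s t : K} {tau : K * K -> K * K}.
Hypotheses (s0 : s != 0) (t0 : t != 0) (st1 : 1 - s * t != 0).
Hypothesis tauP : singular_pair (bialexander s t) tau.

(** Second coordinate of the relation that moves [tau] from the first two
    strands to the last two. *)
Lemma singular_pair_affine x y z :
  (tau (t * x + (1 - s * t) * (s * z), t * y + (1 - s * t) * z)).1
    = t * (tau (x, y)).1 + (1 - s * t) * (s * z).
Proof.
by have [] := sp_braid12 tauP (x, y, z).
Qed.

Lemma singular_pair_scale_s x y :
  (tau (s * x, s * y)).1 = s * (tau (x, y)).1.
Proof.
have := sp_braid23 tauP (0, x, y).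
by rewrite /on12 /on23 /bialexander /= => -[<- _].
Qed.

(** Third coordinate of the other mixed braid relation, divided by 1 - st. *)
Lemma singular_pair_snd x y :
  (tau (x, y)).2 = t * x + y - t * (tau (x, y)).1.
Proof.
have := sp_braid23 tauP (0, x, y).
rewrite /on12 /on23 /bialexander /= => -[_ e].
apply: (mulfI st1).
set f := (tau (x, y)).1 in e *; set g := (tau (x, y)).2 in e *.
have -> : (1 - s * t) * g
  = t * (t * 0 + (1 - s * t) * f) + (1 - s * t) * g - t * (1 - s * t) * f.
  by ring.
by rewrite e; ring.
Qed.

Lemma singular_pair_scale_t x y :
  (tau (t * x, t * y)).1 = t * (tau (x, y)).1.
Proof.
by have := singular_pair_affine x y 0; rewrite !mulr0 !addr0.
Qed.

Lemma singular_pair_fst x y :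
  (tau (x, y)).1 = (tau (x - s * y, 0)).1 + s * y.
Proof.
(* The affine relation at ((x - s y)/t, 0) with (1 - st) z = y, so that its
   translation vector is y (s, 1). *)
have := singular_pair_affine ((x - s * y) / t) 0 (y / (1 - s * t)).
rewrite -singular_pair_scale_t !mulr0 add0r.
have -> : t * ((x - s * y) / t) = x - s * y by field.
have -> : (1 - s * t) * (s * (y / (1 - s * t))) = s * y by field.
have -> : (1 - s * t) * (y / (1 - s * t)) = y by field.
by rewrite subrK.
Qed.

Lemma singular_pair_odd x : (tau (- x, 0)).1 = - (tau (x, 0)).1.
Proof.
have /(congr1 fst) := sp_comm tauP (x, 0); rewrite /bialexander /=.
rewrite !mulr0 addr0 singular_pair_fst singular_pair_snd addr0.
have -> : 0 - s * (t * x) = s * (t * - x) by ring.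
have scale c : (c == s) || (c == t) ->
    forall z, (tau (c * z, 0)).1 = c * (tau (z, 0)).1.
  case/orP=> /eqP-> z.
    by rewrite -singular_pair_scale_s mulr0.
  by rewrite -singular_pair_scale_t mulr0.
rewrite !scale ?eqxx ?orbT // mulrBr addrC => /addrI e.
by apply: (mulfI t0); apply: (mulfI s0); rewrite e !mulrN.
Qed.

(** Homogeneity under nonzero scalars alone does not give phi(0) = 0 when the
    only scalar is 1; here [s] and [t] cannot both be 1. *)
Lemma singular_pair_fst00 : (tau (0, 0)).1 = 0.
Proof.
have := singular_pair_scale_s 0 0; have := singular_pair_scale_t 0 0.
rewrite !mulr0; set f := (tau _).1 => et es.
apply: (mulfI st1).
by rewrite mulr0 mulrBl mul1r -mulrA -et -es subrr.
Qed.

End SingularPair.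

(** With phi(x) = tau^1(x, 0) linear, its slope is read off at (0, 1): it equals
    1 - a/s because tau^1(0, 1) = phi(- s) + s. *)
Lemma singular_pair_formula (K : finFieldType) (s t : K)
    (tau : K * K -> K * K) :
    s != 0 -> t != 0 -> t != s^-1 ->
    <<[set u : {unit K} | val u \in [:: -1; s; t]]>>%g = [set: {unit K}] ->
    singular_pair (bialexander s t) tau ->
  tau =1 tau_lin s t (tau (0, 1)).1.
Proof.
move=> s0 t0 ts gen tauP.
have st1 : 1 - s * t != 0.
  apply: contra ts; rewrite subr_eq0 => /eqP e; apply/eqP.
  by apply: (mulfI s0); rewrite -e divff.
pose phi z := (tau (z, 0)).1.
have phi_hom : forall c z : K, c != 0 -> phi (c * z) = c * phi z.
  apply: (homogeneous_of_generators phi _ gen) => u.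
  rewrite !inE => /or3P[] /eqP-> z; rewrite /phi.
  - by rewrite !mulN1r (singular_pair_odd s0 t0 st1 tauP).
  - by rewrite -(singular_pair_scale_s tauP) mulr0.
  - by rewrite -(singular_pair_scale_t tauP) mulr0.
have phi_lin z : phi z = z * phi 1.
  have [->|z0] := eqVneq z 0.
    by rewrite mul0r /phi (singular_pair_fst00 st1 tauP).
  by rewrite -phi_hom // mulr1.
have fstE x y : (tau (x, y)).1 = (x - s * y) * phi 1 + s * y.
  by rewrite (singular_pair_fst t0 st1 tauP) -/(phi _) phi_lin.
case=> x y; rewrite [tau _]surjective_pairing (singular_pair_snd st1 tauP).
rewrite !fstE /tau_lin /=; congr (_, _); field; exact: s0.
Qed.

Lemma linear_tau_lin (K : fieldType) (s t a : K) :
  linear (tau_lin s t a : K^o * K^o -> K^o * K^o).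
Proof.
move=> c [x y] [z w]; rewrite /tau_lin /=.
by congr (_, _); rewrite /= /GRing.scale /=; ring.
Qed.

Lemma bijective_tau_lin (K : fieldType) (s t a : K) :
    s != 0 -> a != 0 ->
  bijective (tau_lin s t a) <-> (s * t + 1) * a != s.
Proof.
move=> s0 a0; split=> [/bij_inj inj|det0].
  apply: contra a0 => /eqP e.
  (* The vector (a, a/s - 1) always cancels the first coordinate; the second
     is then minus the determinant. *)
  have : tau_lin s t a (a, a / s - 1) = tau_lin s t a (0, 0).
    rewrite /tau_lin /=; congr (_, _); first by field.
    have -> : a * t / s * a + (1 - a * t) * (a / s - 1)
      = ((s * t + 1) * a - s) / s by field.
    by rewrite e subrr mul0r !mulr0 addr0.
  by move/inj=> [-> _].
have d0 : s - (s * t + 1) * a != 0 by rewrite subr_eq0 eq_sym.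
(* The adjugate matrix divided by the determinant, both multiplied by s. *)
exists (fun p => (s * ((1 - a * t) * p.1 - a * p.2) / (s - (s * t + 1) * a),
  ((s - a) * p.2 - a * t * p.1) / (s - (s * t + 1) * a))).
  by case=> x y; rewrite /tau_lin /=; congr (_, _); field; rewrite ?s0 ?d0.
by case=> x y; rewrite /tau_lin /=; congr (_, _); field; rewrite ?s0 ?d0.
Qed.

Theorem theorem18 (K : finFieldType) (s t : K)
    (hs : s != 0) (ht : t != 0) (hst : t != s^-1)
    (hgen : <<[set u : {unit K} | val u \in [:: -1; s; t]%R]>>%g = [set: {unit K}]) :
  [/\ forall tau : K * K -> K * K, singular_pair (bialexander s t) tau ->
        linear (tau : K^o * K^o -> K^o * K^o)
        /\ let a := (tau (0, 1)).1 in
           [/\ a != 0,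
               forall y : K, (tau (0, y)).1 = a * y,
               forall x : K, (tau (s * x, 0)).2 = a * t * x
             & forall x y : K, tau (x, y) = tau_lin s t a (x, y)],
      forall a : K, a != 0 ->
        (bijective (tau_lin s t a) <-> (s * t + 1) * a != s)
    & (#|[set tau : {ffun K * K -> K * K} |
           `[< singular_pair (bialexander s t) tau >]]| <= #|K| - 1)%N].
Proof.
have tauE tau := @singular_pair_formula K s t tau hs ht hst hgen.
have a_neq0 tau : singular_pair (bialexander s t) tau -> (tau (0, 1)).1 != 0.
  (* If a = 0 then tau^1(0, y) = a y is constant, against left invertibility. *)
  move=> tauP; apply/eqP=> a0; have := tauE tau tauP; rewrite a0 => tau0.
  have [y [_ uniq_y]] := sp_linv tauP 0 0.
  have fst0 z : (tau (0, z)).1 = 0 by rewrite tau0 /= mul0r mulr0 addr0.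
  have /eqP := oner_neq0 K; apply.
  by rewrite -(uniq_y 1 (fst0 1)) (uniq_y 0 (fst0 0)).
split=> [tau tauP|a a0|].
- have {}tauE := tauE tau tauP; split.
    by rewrite (funext tauE); apply: linear_tau_lin.
  set a := (tau (0, 1)).1 in tauE *; split=> [|y|x|x y]; last exact: tauE.
  + exact: a_neq0.
  + by rewrite tauE /= mulr0 addr0.
  + by rewrite tauE /=; field.
- exact: bijective_tau_lin.
- have <- : #|[set~ (0 : K)]| = (#|K| - 1)%N by rewrite cardsC1 subn1.
  pose param (tau : {ffun K * K -> K * K}) := (tau (0, 1)).1.
  rewrite -(@card_in_imset _ _ param) => [|tau1 tau2].
    apply/subset_leq_card/subsetP=> _ /imsetP[tau + ->].
    by rewrite !inE => /asboolP; apply: a_neq0.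
  rewrite !inE => /asboolP tau1P /asboolP tau2P eq_param.
  apply/ffunP=> p; rewrite (tauE _ tau1P) (tauE _ tau2P).
  by congr (tau_lin _ _ _ _).
Qed.
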